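(* Let $m,n$ be positive integers, let $X=\mathbf{P}^{2n+1}\times\cdots\times\mathbf{P}^{2n+1}$ ($m$ factors), and let $\mathscr{L}=\mathcal{O}_X(1,\dots,1)$, an ample line bundle. Put $N=h^0(X,\mathcal{O}_X(1,\dots,1))-1$. Let $\alpha,\beta,\gamma$ be positive integers satisfying at least one of the following conditions: (a) $\beta\ge 2\gamma+N-1$ and $\beta\ge\alpha+\gamma$; (b) $\beta\ge\alpha+\gamma+N$. Then there exists a linear monad on $X$ of the form $$0\longrightarrow \mathcal{O}_X(-1,\dots,-1)^{\oplus\alpha}\xrightarrow{\ f\ }\mathcal{O}_X^{\oplus\beta}\xrightarrow{\ g\ }\mathcal{O}_X(1,\dots,1)^{\oplus\gamma}\longrightarrow 0 .$$
   Context: Varieties are over $\mathbb{C}$. For $X=\mathbf{P}^{a_1}\times\cdots\times\mathbf{P}^{a_r}$ with projections $p_i:X\to\mathbf{P}^{a_i}$, $\mathcal{O}_X(d_1,\dots,d_r)=p_1^*\mathcal{O}_{\mathbf{P}^{a_1}}(d_1)\otimes\cdots\otimes p_r^*\mathcal{O}_{\mathbf{P}^{a_r}}(d_r)$. A monad on a nonsingular projective variety $X$ is a complex of vector bundles $0\to M_0\xrightarrow{a}M_1\xrightarrow{b}M_2\to0$ (so $b\circ a=0$) that is exact at $M_0$ and at $M_2$, i.e. $a$ is injective and $b$ is surjective. For a very ample line bundle $\mathscr{L}$ and finite-dimensional vector spaces $V,W,U$, a linear monad is a monad of the form $0\to V\otimes\mathscr{L}^{-1}\xrightarrow{A}W\otimes\mathcal{O}_X\xrightarrow{B}U\otimes\mathscr{L}\to0$,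 with $A\in\operatorname{Hom}(V,W)\otimes H^0(\mathscr{L})$ injective and $B\in\operatorname{Hom}(W,U)\otimes H^0(\mathscr{L})$ surjective. *)

(* Defs.v *)
From mathcomp Require Import all_boot all_order all_algebra.
From mathcomp Require Import classical_sets reals.
From mathcomp Require Import complex.
From mathcomp Require Import mpoly.

Set Implicit Arguments.
Unset Strict Implicit.
Unset Printing Implicit Defensive.

Import GRing.Theory.
Local Open Scope ring_scope.
Local Open Scope classical_set_scope.

(* The variety X = P^k x ... x P^k (m factors) over a field K is handled through
   homogeneous coordinates: an m x k.+1 matrix with nonzero rows represents the
   point of X whose i-th component is the line spanned by row i.  Two such
   matrices represent the same point when they differ by an independent
   rescaling of the rows; Zariski open sets are stable under rescaling, and
   sections of O_X(d_1,...,d_m) are the regular functions of multidegree d in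
   the homogeneous coordinates. *)
Section MultiProjective.
Variables (K : fieldType) (m k : nat).

Definition mproj := {x : 'M[K]_(m, k.+1) | [forall i, row i x != 0]}.

(* The variable of index mxvec_index i j is the j-th coordinate on factor i. *)
Definition coord_ring := {mpoly K[m * k.+1]}.

Definition eval_at (F : coord_ring) (x : mproj) : K :=
  F.@[fun v => mxvec (val x) 0 v].

Definition multihomog (e : 'I_m -> nat) (F : coord_ring) : Prop :=
  forall mon, mon \in msupp F ->
    forall i : 'I_m, (\sum_(j < k.+1) mon (mxvec_index i j))%N = e i.

Definition zariski_open (U : set mproj) : Prop :=
  exists2 S : set coord_ring,
    (forall F, S F -> exists e, multihomog e F) &
    U = [set x | exists2 F, S F & eval_at F x != 0].

(* s is a section of O_X(d) over the open set U.  Only the values of s on U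
   matter: two functions that agree on U are the same section. *)
Definition is_section (d : 'I_m -> int) (U : set mproj) (s : mproj -> K) : Prop :=
  forall x, U x -> exists V : set mproj,
    [/\ zariski_open V, V x, V `<=` U &
        exists (e e' : 'I_m -> nat) (F G : coord_ring),
          [/\ multihomog e F, multihomog e' G,
              (forall i, (e i)%:Z - (e' i)%:Z = d i) &
              forall y, V y ->
                eval_at G y != 0 /\ s y = eval_at F y / eval_at G y]].

(* dim_K H^0(X, O_X(d)) = h, i.e. there is a basis of h global sections. *)
Definition has_h0 (d : 'I_m -> int) (h : nat) : Prop :=
  exists b : 'I_h -> mproj -> K,
    [/\ forall j, is_section d setT (b j),
        forall c : 'I_h -> K,
          (forall x, \sum_j c j * b j x = 0) -> forall j, c j = 0 &
        forall s, is_section d setT s ->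
          exists c : 'I_h -> K, forall x, s x = \sum_j c j * b j x].

(* Sections of O_X(d)^{+r} over U, as column vectors. *)
Definition is_section_sum (r : nat) (d : 'I_m -> int) (U : set mproj)
    (s : mproj -> 'cV[K]_r) : Prop :=
  forall i, is_section d U (fun x => s x i 0).

(* Elements of Hom(K^p, K^q) (x) H^0(X, O_X(d)). *)
Definition is_section_matrix (q p : nat) (d : 'I_m -> int)
    (A : mproj -> 'M[K]_(q, p)) : Prop :=
  forall i j, is_section d setT (fun x => A x i j).

(* A matrix of global sections of O_X(d' - d) acts by multiplication as a
   morphism of sheaves O_X(d)^{+p} -> O_X(d')^{+q}. *)
Definition act (q p : nat) (A : mproj -> 'M[K]_(q, p))
    (s : mproj -> 'cV[K]_p) : mproj -> 'cV[K]_q :=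
  fun x => A x *m s x.

Definition sheaf_injective (q p : nat) (d : 'I_m -> int)
    (A : mproj -> 'M[K]_(q, p)) : Prop :=
  forall U s, zariski_open U -> is_section_sum d U s ->
    (forall x, U x -> act A s x = 0) -> forall x, U x -> s x = 0.

Definition sheaf_surjective (q p : nat) (d d' : 'I_m -> int)
    (A : mproj -> 'M[K]_(q, p)) : Prop :=
  forall U t, zariski_open U -> is_section_sum d' U t ->
    forall x, U x -> exists V s,
      [/\ zariski_open V, V x, V `<=` U, is_section_sum d V s &
          forall y, V y -> act A s y = t y].

(* The multidegree (t, ..., t). *)
Definition diag_deg (t : int) : 'I_m -> int := fun=> t.

(* 0 -> O(-1,...,-1)^{+a} --A--> O^{+b} --B--> O(1,...,1)^{+c} -> 0 is a
   linear monad.  As usual for monads, A is only required to be injective as a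
   morphism of sheaves, not on every fibre. *)
Record linear_monad (a b c : nat) (A : mproj -> 'M[K]_(b, a))
    (B : mproj -> 'M[K]_(c, b)) : Prop := LinearMonad {
  monad_left : is_section_matrix (diag_deg 1) A;
  monad_right : is_section_matrix (diag_deg 1) B;
  monad_complex : forall U s, zariski_open U ->
    is_section_sum (diag_deg (-1)) U s ->
    forall x, U x -> act B (act A s) x = 0;
  monad_injective : sheaf_injective (diag_deg (-1)) A;
  monad_surjective : sheaf_surjective (diag_deg 0) (diag_deg 1) B
}.

End MultiProjective.

Arguments diag_deg m t : clear implicits.
Arguments has_h0 K m k d h : clear implicits.

(* Main.v *)
(* Let z_0, ..., z_{c-1} be the monomials of multidegree (1,...,1).  They have no
   common zero on X, and evaluating them at the points whose rows are unit vectors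
   shows that they are linearly independent, so c <= N + 1.  Let T(z) be the banded
   matrix of multiplication by the polynomial with coefficients z_l; it has maximal
   rank wherever the z_l do not all vanish.
   Under (b), take g = (T | 0) and f = (0 ; z_0 I), T being built on all the z_l.
   Under (a), take g = (T | z_0 I), T being built on z_1, ..., z_{c-1}, and let f
   consist of the first alpha columns of (z_0 I ; - T).
   In both cases g has maximal rank at every point, hence is locally split by
   Cramer's rule, and f has a left inverse up to the factor z_0, hence is injective
   on sections because X is irreducible. *)
Require Import Defs.
From mathcomp Require Import all_boot all_order all_algebra.
From mathcomp Require Import reals.
From mathcomp Require Import complex.
From mathcomp Require Import classical_sets mpoly zify.

Import GRing.Theory.

(** * Banded matrices of polynomial multiplication and their rank *)

Section Band.
Set Implicit Arguments.
Unset Strict Implicit.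
Local Open Scope ring_scope.

(** A Toeplitz, Sylvester-type matrix: in monomial bases and acting on row vectors, it is
    multiplication by [p] on polynomials of degree below [c], truncated to the first [b]
    coefficients. *)
Definition band_mx {A : comNzRingType} (c b : nat) (p : {poly A}) : 'M[A]_(c, b) :=
  \matrix_(i, j) ('X^i * p)`_j.

Lemma map_band_mx (A B : comNzRingType) (f : {rmorphism A -> B}) c b p :
  map_mx f (band_mx c b p) = band_mx c b (map_poly f p).
Proof.
by apply/matrixP => i j; rewrite !mxE !coefXnM coef_map; case: ifP; rewrite ?rmorph0.
Qed.

Lemma mul_band_mx (A : comNzRingType) c b (p : {poly A}) (w : 'rV[A]_c) :
  w *m band_mx c b p = poly_rV (rVpoly w * p).
Proof.
apply/rowP => j; rewrite !mxE /rVpoly poly_def big_distrl coef_sum /=.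
by apply: eq_bigr => i _; rewrite valK mxE -scalerAl coefZ.
Qed.

(** Multiplication by a nonzero polynomial is injective, and the bound on [b] ensures that no
    coefficient of the product is truncated. *)
Lemma row_free_band_mx (K : fieldType) c b (p : {poly K}) :
  p != 0 -> (c + (size p).-1 <= b)%N -> row_free (band_mx c b p).
Proof.
move=> p0 le_b; apply/inj_row_free => w; rewrite mul_band_mx => w0.
have [wp0 | wp0] := eqVneq (rVpoly w) 0; first by rewrite -[w]rVpolyK wp0 linear0.
have sz : (size (rVpoly w * p)%R <= b)%N.
  have szw : (size (rVpoly w) <= c)%N by exact: size_poly.
  have sp0 : (0 < size p)%N by rewrite size_poly_gt0.
  rewrite size_mul //; apply: leq_trans le_b; rewrite -(prednK sp0) addnS /=.
  by rewrite leq_add2r.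
have := poly_rV_K sz; rewrite w0 linear0 => /esym/eqP.
by rewrite mulf_eq0 (negPf wp0) (negPf p0).
Qed.

End Band.

(** * Multihomogeneous polynomials and determinants *)

Section Homogeneous.
Set Implicit Arguments.
Unset Strict Implicit.
Local Open Scope ring_scope.
Variables (K : fieldType) (m k : nat).
Implicit Types (F G : coord_ring K m k) (x y : mproj K m k).

Local Notation ev x := (meval (fun v => mxvec (val x) 0 v)).

Lemma multihomog_eq e e' F : e =1 e' -> multihomog e F -> multihomog e' F.
Proof. by move=> ee hF mon /hF h i; rewrite h. Qed.

Lemma multihomog0 e : multihomog e (0 : coord_ring K m k).
Proof. by move=> mon; rewrite msupp0. Qed.

Lemma multihomogC (c : K) : multihomog (fun=> 0%N) (mpolyC (m * k.+1) c : coord_ring K m k).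
Proof.
move=> mon; rewrite msuppC; case: eqP => // _; rewrite inE => /eqP-> i.
by rewrite big1 // => j _; rewrite mnm0E.
Qed.

Arguments multihomog0 e mon _ _ : clear implicits.
Arguments multihomogC c mon _ _ : clear implicits.

Lemma multihomogD e F G : multihomog e F -> multihomog e G -> multihomog e (F + G).
Proof.
move=> hF hG mon /msuppD_le; rewrite mem_cat => /orP[/hF | /hG]; exact.
Qed.

Lemma multihomogM e e' F G : multihomog e F -> multihomog e' G ->
  multihomog (fun i => e i + e' i)%N (F * G).
Proof.
move=> hF hG mon /msuppM_le/allpairsP[[m1 m2] /= [h1 h2 ->]] i.
rewrite -(hF _ h1) -(hG _ h2) -big_split /=.
by apply: eq_bigr => j _; rewrite mnmDE.
Qed.

Lemma multihomog_sum (I : finType) e (F : I -> coord_ring K m k) :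
  (forall i, multihomog e (F i)) -> multihomog e (\sum_i F i).
Proof.
by move=> h; elim/big_ind: _ => //; [exact: multihomog0 | exact: multihomogD].
Qed.

Lemma multihomog_prod (I : finType) (e : I -> 'I_m -> nat) (F : I -> coord_ring K m k) :
  (forall i, multihomog (e i) (F i)) ->
  multihomog (fun a => \sum_i e i a)%N (\prod_i F i).
Proof.
(* Unfolded to folds over the same list, the product and its multidegree are handled by a single
   induction. *)
move=> h; rewrite unlock; elim: (index_enum I) => [|i s IHs] /=.
  exact: multihomogC.
exact: multihomogM.
Qed.

Lemma multihomogX i j :
  multihomog (fun a => (a == i) : nat) ('X_(mxvec_index i j) : coord_ring K m k).
Proof.
move=> mon; rewrite msuppX inE => /eqP-> a.
under eq_bigr => b _ do rewrite mnm1E.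
have inj : forall b, (mxvec_index i j == mxvec_index a b) = (a == i) && (b == j).
  move=> b; have [g gK _] := curry_mxvec_bij m k.+1.
  apply/eqP/andP => [/(congr1 g) | [/eqP-> /eqP->] //].
  by rewrite (gK (i, j)) // (gK (a, b)) // => -[-> ->].
under eq_bigr => b _ do rewrite inj.
have [_|_] := eqVneq a i; last by rewrite big1.
by rewrite (bigD1 j) //= eqxx big1 ?addn0 // => b /negPf->.
Qed.

(** Each term of the Leibniz expansion is a sign times [n] entries of degree [d]. *)
Lemma multihomog_det n d (P : 'M[coord_ring K m k]_n) :
  (forall i j, multihomog (fun=> d) (P i j)) ->
  multihomog (fun=> (n * d)%N) (\det P).
Proof.
move=> hP; apply: multihomog_sum => s.
(* The sign is rewritten as a constant polynomial, which has multidegree zero. *)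
have -> : (-1) ^+ perm.odd_perm s
    = mpolyC (m * k.+1) ((-1) ^+ perm.odd_perm s) :> coord_ring K m k.
  by rewrite rmorphXn rmorphN1.
apply: (@multihomog_eq (fun a => 0 + \sum_(i < n) d)%N).
  by move=> a; rewrite sum_nat_const card_ord.
exact: (multihomogM (multihomogC _)
  (multihomog_prod (e := fun _ _ => d) (fun i => hP i (perm.fun_of_perm s i)))).
Qed.

Lemma multihomog_adj n d (P : 'M[coord_ring K m k]_n) i j :
  (forall i j, multihomog (fun=> d) (P i j)) ->
  multihomog (fun=> (n.-1 * d)%N) (\adj P i j).
Proof.
move=> hP; rewrite mxE /cofactor.
have -> : (-1) ^+ (j + i) = mpolyC (m * k.+1) ((-1) ^+ (j + i)) :> coord_ring K m k.
  by rewrite rmorphXn rmorphN1.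
apply: (multihomogM (multihomogC _)); apply: multihomog_det => a b.
by rewrite !mxE.
Qed.

Lemma multihomog_mulmx q r s d d' (P : 'M[coord_ring K m k]_(q, r)) (Q : 'M_(r, s)) i j :
  (forall i j, multihomog (fun=> d) (P i j)) ->
  (forall i j, multihomog (fun=> d') (Q i j)) ->
  multihomog (fun=> (d + d')%N) ((P *m Q) i j).
Proof. by move=> hP hQ; rewrite mxE; apply: multihomog_sum => l; apply: multihomogM. Qed.


(** * Zariski open sets, local sections and surjectivity *)

Local Open Scope classical_set_scope.

Lemma zariski_openD e F : multihomog e F -> zariski_open [set x | eval_at F x != 0].
Proof.
move=> hF; exists [set F] => [_ ->|]; first by exists e.
by apply/seteqP; split=> x /= [] //; [exists F | move=> _ -> ].
Qed.

Lemma zariski_open_basic (U : set (mproj K m k)) x : zariski_open U -> U x ->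
  exists e F, [/\ multihomog e F, eval_at F x != 0 &
    forall y, eval_at F y != 0 -> U y].
Proof.
move=> [S hS ->] [F SF Fx]; have [e hF] := hS _ SF.
by exists e, F; split=> // y Fy; exists F.
Qed.

Lemma eval_atM F G x : eval_at (F * G) x = eval_at F x * eval_at G x.
Proof. exact: mevalM. Qed.

Lemma eval_atD F G x : eval_at (F + G) x = eval_at F x + eval_at G x.
Proof. exact: mevalD. Qed.

Lemma zariski_openT : zariski_open [set: mproj K m k].
Proof.
have -> : [set: mproj K m k] = [set x | eval_at (mpolyC (m * k.+1) 1) x != 0].
  by apply/seteqP; split=> x //= _; rewrite /eval_at mevalC oner_neq0.
exact: zariski_openD (multihomogC 1).
Qed.

Lemma zariski_openI (U V : set (mproj K m k)) :
  zariski_open U -> zariski_open V -> zariski_open (U `&` V).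
Proof.
move=> [S hS ->] [T hT ->].
exists [set H | exists F G, [/\ S F, T G & H = F * G]].
  move=> _ [F [G [/hS[e hF] /hT[e' hG] ->]]].
  by exists (fun i => e i + e' i)%N; apply: multihomogM.
apply/seteqP; split=> x /=.
  move=> [[F SF Fx] [G TG Gx]]; exists (F * G); first by exists F, G.
  by rewrite eval_atM mulf_neq0.
move=> [_ [F [G [SF TG ->]]]]; rewrite eval_atM mulf_eq0 negb_or => /andP[Fx Gx].
by split; [exists F | exists G].
Qed.

Lemma is_section_frac (d : 'I_m -> int) (U : set (mproj K m k)) e e' F G :
  zariski_open U -> multihomog e F -> multihomog e' G ->
  (forall i, (e i)%:Z - (e' i)%:Z = d i) -> (forall y, U y -> eval_at G y != 0) ->
  is_section d U (fun y => eval_at F y / eval_at G y).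
Proof.
move=> oU hF hG hd G0 x Ux; exists U; split=> //.
by exists e, e', F, G; split=> // y /G0 Gy.
Qed.

Lemma eq_is_section (d : 'I_m -> int) (U : set (mproj K m k)) s s' :
  (forall x, U x -> s x = s' x) -> is_section d U s -> is_section d U s'.
Proof.
move=> ss hs x /hs[V [oV Vx VU [e [e' [F [G [hF hG hd h]]]]]]].
exists V; split=> //; exists e, e', F, G; split=> // y Vy.
by have [? <-] := h y Vy; rewrite ss //; apply: VU.
Qed.

Lemma is_section_eval_at (d : nat) (U : set (mproj K m k)) F :
  zariski_open U -> multihomog (fun=> d) F ->
  is_section (diag_deg m d%:Z) U (eval_at F).
Proof.
have ev1 x : eval_at (mpolyC (m * k.+1) 1) x = 1 :> K by rewrite /eval_at mevalC.
move=> oU hF; apply: (@eq_is_section _ _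
    (fun x => eval_at F x / eval_at (mpolyC (m * k.+1) 1) x)).
  by move=> x _; rewrite ev1 divr1.
apply: (is_section_frac oU hF (multihomogC 1)) => [i|y _]; first exact: subr0.
by rewrite ev1 oner_neq0.
Qed.

Lemma is_sectionS (d : 'I_m -> int) (U V : set (mproj K m k)) s :
  zariski_open V -> V `<=` U -> is_section d U s -> is_section d V s.
Proof.
move=> oV VU hs x Vx.
have [W [oW Wx WU [e [e' [F [G [hF hG hd h]]]]]]] := hs x (VU _ Vx).
exists (V `&` W); split=> //; first exact: zariski_openI.
by exists e, e', F, G; split=> // y [_ /h].
Qed.

Lemma is_sectionM (d d' d'' : 'I_m -> int) (U : set (mproj K m k)) s t :
  (forall i, d i + d' i = d'' i) ->
  is_section d U s -> is_section d' U t -> is_section d'' U (fun x => s x * t x).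
Proof.
move=> dd hs ht x Ux.
have [V [oV Vx VU [e1 [e1' [F1 [G1 [hF1 hG1 hd1 h1]]]]]]] := hs x Ux.
have [W [oW Wx WU [e2 [e2' [F2 [G2 [hF2 hG2 hd2 h2]]]]]]] := ht x Ux.
exists (V `&` W); split=> //; [exact: zariski_openI | by move=> y [/VU] |].
exists (fun i => e1 i + e2 i)%N, (fun i => e1' i + e2' i)%N, (F1 * F2), (G1 * G2).
split; [exact: multihomogM | exact: multihomogM | |].
  by move=> i; rewrite -dd -hd1 -hd2 !PoszD opprD addrACA.
move=> y [/h1[G1y ->] /h2[G2y ->]]; rewrite !eval_atM mulf_neq0 //; split=> //.
by rewrite mulf_div.
Qed.

Lemma is_sectionD (d : 'I_m -> int) (U : set (mproj K m k)) s t :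
  is_section d U s -> is_section d U t -> is_section d U (fun x => s x + t x).
Proof.
move=> hs ht x Ux.
have [V [oV Vx VU [e1 [e1' [F1 [G1 [hF1 hG1 hd1 h1]]]]]]] := hs x Ux.
have [W [oW Wx WU [e2 [e2' [F2 [G2 [hF2 hG2 hd2 h2]]]]]]] := ht x Ux.
exists (V `&` W); split=> //; [exact: zariski_openI | by move=> y [/VU] |].
(* Both fractions have degree [d], so the cross products [F1 * G2] and [F2 * G1] share a multidegree
   and their sum is multihomogeneous. *)
have dd i : (e1 i + e2' i = e2 i + e1' i)%N.
  by have := hd1 i; have := hd2 i; lia.
exists (fun i => e1 i + e2' i)%N, (fun i => e1' i + e2' i)%N.
exists (F1 * G2 + F2 * G1), (G1 * G2).
split; [|exact: multihomogM | |].
- apply: multihomogD; first exact: multihomogM.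
  by apply: (multihomog_eq _ (multihomogM hF2 hG1)) => i; rewrite dd.
- by move=> i; rewrite -hd1 !PoszD; lia.
move=> y [/h1[G1y ->] /h2[G2y ->]]; rewrite eval_atD !eval_atM mulf_neq0 //.
by split=> //; rewrite addf_div.
Qed.

Lemma is_section_sum0 (I : finType) (U : set (mproj K m k)) (s : I -> mproj K m k -> K) :
  zariski_open U -> (forall i, is_section (diag_deg m 0) U (s i)) ->
  is_section (diag_deg m 0) U (fun x => \sum_i s i x).
Proof.
move=> oU hs; rewrite unlock; elim: (index_enum I) => [|i l IHl] /=.
  apply: (@eq_is_section _ _ (eval_at 0)); first by move=> x _; rewrite /eval_at meval0.
  exact: (is_section_eval_at oU (multihomog0 _)).
exact: is_sectionD.
Qed.

(* At x, choose a constant C with G x *m C = 1; near x, C *m (G *m C)^-1 is a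
   right inverse of G, which Cramer's rule writes as a matrix of fractions. *)
Lemma sheaf_surjective_rank (c b : nat) (G : 'M[coord_ring K m k]_(c, b)) :
  (forall i j, multihomog (fun=> 1%N) (G i j)) ->
  (forall x, row_free (map_mx (fun F => eval_at F x) G)) ->
  sheaf_surjective (diag_deg m 0) (diag_deg m 1) (fun x => map_mx (fun F => eval_at F x) G).
Proof.
move=> hG free U t oU ht x Ux.
have [C GC] := row_freeP (free x).
pose C' := map_mx (@mpolyC (m * k.+1) K) C : 'M[coord_ring K m k]_(b, c).
have evC y : map_mx (ev y) C' = C by apply/matrixP => i j; rewrite !mxE mevalC.
have hC' i j : multihomog (fun=> 0%N) (C' i j) by rewrite mxE; apply: multihomogC.
pose P := G *m C'.
have hP i j : multihomog (fun=> 1%N) (P i j) by exact: multihomog_mulmx hG hC'.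
have hdet := multihomog_det hP; rewrite muln1 in hdet.
pose Q := C' *m \adj P.
have hQ i j : multihomog (fun=> c.-1) (Q i j).
  apply: (multihomog_mulmx (d := 0)) => // a e.
  by have := multihomog_adj (i := a) (j := e) hP; rewrite muln1.
pose V := U `&` [set y | eval_at (\det P) y != 0].
have oV : zariski_open V by apply: zariski_openI => //; apply: zariski_openD hdet.
have VU : V `<=` U by move=> y [].
exists V, (fun y => \col_i \sum_j (eval_at (Q i j) y / eval_at (\det P) y) * t y j 0).
split=> //.
(* At [x] the matrix [P] is the identity, by the choice of [C]. *)
- split=> //=; have -> : eval_at (\det P) x = 1; last exact: oner_neq0.
  by rewrite /eval_at -det_map_mx map_mxM evC GC det1.
- move=> i; apply: (@eq_is_section _ _ (fun y =>
    \sum_j (eval_at (Q i j) y / eval_at (\det P) y) * t y j 0)).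
    by move=> y _; rewrite mxE.
  apply: is_section_sum0 => // j.
  apply: (@is_sectionM (diag_deg m (-1)) (diag_deg m 1)) => //; last exact: is_sectionS (ht j).
  apply: (is_section_frac oV (hQ i j) hdet) => [a|y [] //].
  (* The existence of [j < c] makes [c] positive, so the degree [c.-1 - c] of the fraction really is
     -1. *)
  by rewrite /diag_deg; move: (ltn_ord j); lia.
move=> y [_ /= dy]; rewrite /act.
have -> : (\col_i \sum_j (eval_at (Q i j) y / eval_at (\det P) y) * t y j 0)
    = (eval_at (\det P) y)^-1 *: (map_mx (ev y) Q *m t y).
  apply/colP => i; rewrite mxE [RHS]mxE [X in _ = _ * X]mxE big_distrr /=.
  apply: eq_bigr => j _; rewrite [map_mx _ _ _ _]mxE -/(eval_at _ y) mulrA.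
  by rewrite (mulrC _^-1).
rewrite -scalemxAr mulmxA -[map_mx (fun F => eval_at F y) G]/(map_mx (ev y) G) -map_mxM mulmxA.
rewrite -/P mul_mx_adj map_scalar_mx mul_scalar_mx scalerA -/(eval_at _ y).
by rewrite mulVf // scale1r.
Qed.

End Homogeneous.

(** * Irreducibility of X and injectivity on sections *)

Section LinearMonads.
Set Implicit Arguments.
Unset Strict Implicit.
Local Open Scope ring_scope.
Local Open Scope classical_set_scope.
Variables (K : closedFieldType) (m k : nat).
Implicit Types (F G H z : coord_ring K m k) (x y : mproj K m k).

Local Notation ev x := (meval (fun v => mxvec (val x) 0 v)).
Local Notation eval_mx P x := (map_mx (fun F => eval_at F x) P).

Lemma horner_mmap n (h : 'I_n -> {poly K}) (P : {mpoly K[n]}) t :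
  (mmap polyC h P).[t] = P.@[fun v => (h v).[t]].
Proof.
rewrite mevalE /mmap horner_sum; apply: eq_bigr => mon _.
rewrite hornerM hornerC; congr (_ * _); rewrite /mmap1 horner_prod.
by apply: eq_bigr => i _; rewrite horner_exp.
Qed.

Lemma mproj_coord_neq0 x : exists c : 'I_m -> 'I_k.+1, forall i, val x i (c i) != 0.
Proof.
have hx i : exists j, val x i j != 0.
  by have /forallP/(_ i)/rV0Pn[j] := valP x; rewrite mxE; exists j.
exact: fin_all_exists hx.
Qed.

(* Restrict everything to the line joining x and y: nonzero univariate
   polynomials over an infinite field have a common nonroot. *)
Lemma mproj_irreducible F G x y : eval_at F x != 0 -> eval_at G y != 0 ->
  exists w, eval_at F w != 0 /\ eval_at G w != 0.
Proof.
move=> Fx Gy; have [c xc] := mproj_coord_neq0 x.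
pose h i j : {poly K} := (val x i j)%:P + 'X * (val y i j - val x i j)%:P.
pose hv v := mxvec (\matrix_(i, j) h i j) 0 v.
pose M t : 'M[K]_(m, k.+1) := \matrix_(i, j) (h i j).[t].
have hvE t v : (hv v).[t] = mxvec (M t) 0 v.
  by case/mxvec_indexP: v => i j; rewrite /hv !mxvecE !mxE.
have evM t P : (mmap polyC hv P).[t] = P.@[fun v => mxvec (M t) 0 v].
  by rewrite horner_mmap; apply: meval_eq.
have M0 : M 0 = val x by apply/matrixP => i j; rewrite mxE !hornerE.
have M1 : M 1 = val y.
  by apply/matrixP => i j; rewrite mxE hornerD hornerM !hornerC hornerX mul1r subrKC.
have nz t p : p.[t] != 0 -> p != 0 :> {poly K}.
  by apply: contraNneq => ->; rewrite horner0.
have nzF : mmap polyC hv F != 0 by apply: (nz 0); rewrite evM M0.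
have nzG : mmap polyC hv G != 0 by apply: (nz 1); rewrite evM M1.
(* One coordinate per row, nonzero at [x], is followed along the line; if none of these vanishes at
   [t], all rows of [M t] are nonzero and [M t] is a point of X. *)
have nzR : \prod_i h i (c i) != 0.
  by apply/prodf_neq0 => i _; apply: (nz 0); rewrite !hornerE.
have /closed_nonrootP[t] := mulf_neq0 (mulf_neq0 nzF nzG) nzR.
rewrite /root !hornerM !mulf_eq0 !negb_or horner_prod => /andP[/andP[Ft Gt]] /prodf_neq0 Rt.
have Mt : [forall i, row i (M t) != 0].
  by apply/forallP => i; apply/rV0Pn; exists (c i); rewrite !mxE; apply: Rt.
by exists (exist _ (M t) Mt); rewrite /eval_at /= -!evM.
Qed.

(** A section that is nonzero at [x] stays nonzero at some point of its domain where [z] does not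
    vanish, by irreducibility; applying [D] to [A s = 0] there gives [z s = 0], a contradiction. *)
Lemma sheaf_injective_cancel b a (d : 'I_m -> int) (A : mproj K m k -> 'M[K]_(b, a))
    (D : mproj K m k -> 'M[K]_(a, b)) z y :
  (forall x, D x *m A x = (eval_at z x)%:M) -> eval_at z y != 0 ->
  sheaf_injective d A.
Proof.
move=> DA zy U s oU hs As0 x Ux; apply/colP => i; rewrite mxE; apply/eqP/negPn/negP => sx.
have [V [oV Vx VU [e [e' [F [G [_ _ _ sFG]]]]]]] := hs i x Ux.
have [e'' [H [_ Hx HV]]] := zariski_open_basic oV Vx.
(* The factor [H] forces the common nonvanishing point into [V], where [s] is the fraction
   [F / G]. *)
have Fx : eval_at (F * H) x != 0.
  rewrite eval_atM mulf_neq0 //; apply: contraNneq sx => F0.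
  by have [_ ->] := sFG x Vx; rewrite F0 mul0r.
have [w []] := mproj_irreducible Fx zy.
rewrite eval_atM mulf_eq0 negb_or => /andP[Fw /HV Vw] zw.
have [Gw sw] := sFG w Vw; have : s w i 0 != 0 by rewrite sw mulf_neq0 ?invr_eq0.
have := congr1 (mulmx (D w)) (As0 w (VU _ Vw)).
rewrite /act mulmxA DA mulmx0 mul_scalar_mx => /colP/(_ i); rewrite !mxE => /eqP.
by rewrite mulf_eq0 (negPf zw) /= => ->.
Qed.

(** Reduces each construction to matrix identities in the coordinate ring, a left inverse of [F] up
    to the factor [z], and the pointwise rank of [G]. *)
Lemma linear_monad_cancel c b a (G : 'M[coord_ring K m k]_(c, b))
    (F : 'M[coord_ring K m k]_(b, a)) (D : 'M[coord_ring K m k]_(a, b)) z y :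
  (forall i j, multihomog (fun=> 1%N) (G i j)) ->
  (forall i j, multihomog (fun=> 1%N) (F i j)) ->
  G *m F = 0 -> D *m F = z%:M -> eval_at z y != 0 ->
  (forall x, row_free (eval_mx G x)) ->
  linear_monad (fun x => eval_mx F x) (fun x => eval_mx G x).
Proof.
move=> hG hF GF DF zy free; split.
- move=> i j; apply: (eq_is_section (s := eval_at (F i j))); first by move=> x _; rewrite mxE.
  exact: is_section_eval_at (@zariski_openT _ _ _) (hF i j).
- move=> i j; apply: (eq_is_section (s := eval_at (G i j))); first by move=> x _; rewrite mxE.
  exact: is_section_eval_at (@zariski_openT _ _ _) (hG i j).
- move=> U s _ _ x _; rewrite /act mulmxA.
  by rewrite -[eval_mx G x]/(map_mx (ev x) G) -[eval_mx F x]/(map_mx (ev x) F)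
    -map_mxM GF map_mx0 mul0mx.
- apply: (sheaf_injective_cancel (D := fun x => eval_mx D x) _ zy) => x.
  by rewrite -[eval_mx D x]/(map_mx (ev x) D) -[eval_mx F x]/(map_mx (ev x) F)
    -map_mxM DF map_scalar_mx.
exact: sheaf_surjective_rank.
Qed.

(** * Segre coordinates: the monomials of multidegree (1,...,1) *)

Definition coord_monomial (f : {ffun 'I_m -> 'I_k.+1}) : coord_ring K m k :=
  \prod_i 'X_(mxvec_index i (f i)).

Lemma multihomog_coord_monomial f : multihomog (fun=> 1%N) (coord_monomial f).
Proof.
apply: (multihomog_eq _ (multihomog_prod (fun i => @multihomogX K m k i (f i)))) => a.
by rewrite (bigD1 a) //= eqxx big1 // => i; rewrite eq_sym => /negPf->.
Qed.

Lemma eval_coord_monomial f x : eval_at (coord_monomial f) x = \prod_i val x i (f i).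
Proof.
by rewrite /eval_at rmorph_prod; apply: eq_bigr => i _; rewrite /= mevalXU mxvecE.
Qed.

Lemma coord_monomial_neq0 x : exists f, eval_at (coord_monomial f) x != 0.
Proof.
have [c xc] := mproj_coord_neq0 x; exists (finfun c); rewrite eval_coord_monomial.
by apply/prodf_neq0 => i _; rewrite ffunE.
Qed.

(** Take the point whose rows are the unit vectors selected by [g]: the monomial of [f] meets a zero
    entry on any factor where [f] and [g] differ. *)
Lemma coord_monomial_dual (g : {ffun 'I_m -> 'I_k.+1}) :
  exists x, forall f, eval_at (coord_monomial f) x = (f == g)%:R.
Proof.
pose M : 'M[K]_(m, k.+1) := \matrix_(i, j) (j == g i)%:R.
have hM : [forall i, row i M != 0].
  by apply/forallP => i; apply/rV0Pn; exists (g i); rewrite !mxE eqxx oner_neq0.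
exists (exist _ M hM) => f; rewrite eval_coord_monomial /=.
have [-> | nfg] := eqVneq f g; first by rewrite big1 // => i _; rewrite mxE eqxx.
have [i nfgi] : exists i, f i != g i.
  apply/existsP; rewrite -negb_forall; apply: contra nfg => /forallP fg.
  by apply/eqP/ffunP => i; apply/eqP.
by rewrite (bigD1 i) //= mxE (negPf nfgi) mul0r.
Qed.

(** The values of the monomials at their dual points form an identity matrix, which factors through
    [K^h] once the monomials are expanded in a basis of [h] sections. *)
Lemma card_coord_monomial_le h :
  has_h0 K m k (diag_deg m 1) h -> (#|{ffun 'I_m -> 'I_k.+1}| <= h)%N.
Proof.
move=> [b [_ _ span]].
have sp f : exists C : 'I_h -> K,
    forall x, eval_at (coord_monomial f) x = \sum_j C j * b j x.
  apply: span.
  exact: is_section_eval_at (@zariski_openT _ _ _) (@multihomog_coord_monomial f).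
have [C hC] := fin_all_exists sp.
have [pt hpt] := fin_all_exists coord_monomial_dual.
apply: (@mulmx1_min K _ _ (\matrix_(i, j) C (enum_val i) j)
  (\matrix_(j, l) b j (pt (enum_val l)))).
apply/matrixP => i l; rewrite !mxE -(inj_eq enum_val_inj) -hpt hC.
by apply: eq_bigr => j _; rewrite !mxE.
Qed.

(** Numbering the monomials lets them serve as coefficients of a univariate polynomial; positions
    past the end give [0]. *)
Let zs := [seq coord_monomial f | f <- enum {ffun 'I_m -> 'I_k.+1}].
Let c := #|{ffun 'I_m -> 'I_k.+1}|.

Lemma size_coord_monomials : size zs = c. Proof. by rewrite size_map -cardE. Qed.

Lemma card_coord_monomial_gt0 : (0 < c)%N.
Proof. by apply/card_gt0P; exists [ffun=> ord0]. Qed.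

Lemma multihomog_coord_monomials l : multihomog (fun=> 1%N) zs`_l.
Proof.
have [lt_l | le_l] := ltnP l (size zs); last by rewrite nth_default //; apply: multihomog0.
by have /mapP[f _ ->] := mem_nth 0 lt_l; apply: multihomog_coord_monomial.
Qed.

Lemma coord_monomials_neq0 x : exists2 l, (l < c)%N & eval_at zs`_l x != 0.
Proof.
have [f fx] := coord_monomial_neq0 x.
have /(nthP 0)[l lt_l zl] : coord_monomial f \in zs by rewrite map_f ?mem_enum.
by exists l; rewrite -?size_coord_monomials // zl.
Qed.

Lemma coord_monomials_head_neq0 : exists y, eval_at zs`_0 y != 0.
Proof.
have /(mem_nth 0)/mapP[f _ ->] : (0 < size zs)%N.
  by rewrite size_coord_monomials card_coord_monomial_gt0.
by have [y hy] := coord_monomial_dual f; exists y; rewrite hy eqxx oner_neq0.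
Qed.

(** * The two families of monads *)

Lemma multihomog_band r b L (u : nat -> coord_ring K m k) i j :
  (forall l, multihomog (fun=> 1%N) (u l)) ->
  multihomog (fun=> 1%N) (band_mx r b (\poly_(l < L) u l) i j).
Proof.
move=> hu; rewrite mxE coefXnM coef_poly.
by do 2?case: ifP => _ //; apply: multihomog0.
Qed.

(** One coefficient surviving at [x] makes the polynomial nonzero there; its degree may drop at [x],
    but never exceeds [L.-1]. *)
Lemma row_free_band_poly r b L (u : nat -> coord_ring K m k) x l :
  (l < L)%N -> eval_at (u l) x != 0 -> (r + L.-1 <= b)%N ->
  row_free (eval_mx (band_mx r b (\poly_(l < L) u l)) x).
Proof.
move=> lt_l ul le_b; rewrite -[eval_mx _ x]/(map_mx (ev x) _) map_band_mx.
apply: row_free_band_mx.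
  apply: contraNneq ul => /(congr1 (fun p : {poly K} => p`_l)).
  by rewrite coef_map coef_poly lt_l coef0 => ul0; apply/eqP.
apply: leq_trans le_b; rewrite leq_add2l -!subn1 leq_sub2r //.
by rewrite (leq_trans (size_poly _ _)) // size_poly.
Qed.

Lemma multihomog_scalar_mx r z i j :
  multihomog (fun=> 1%N) z -> multihomog (fun=> 1%N) ((z%:M : 'M_r) i j).
Proof. by move=> hz; rewrite mxE; case: eqP => _ //; apply: multihomog0. Qed.

Lemma linear_monad_band_scalar r b a : (a <= b)%N -> (r + (c - 2) <= b)%N ->
  exists (f : mproj K m k -> 'M[K]_(b + r, a)) (g : mproj K m k -> 'M[K]_(r, b + r)),
    linear_monad f g.
Proof.
move=> le_ab le_b; have [y zy] := coord_monomials_head_neq0.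
set z := zs`_0 in zy *; have hz : multihomog (fun=> 1%N) z := @multihomog_coord_monomials 0.
(* The [c.-1] monomials other than [z] give a polynomial of degree at most [c - 2], whence the bound
   on [b]. *)
pose T : 'M[coord_ring K m k]_(r, b) := band_mx r b (\poly_(l < c.-1) zs`_l.+1).
have hT i j : multihomog (fun=> 1%N) (T i j).
  by apply: multihomog_band => l; apply: multihomog_coord_monomials.
(* [T z - z T = 0] because scalar matrices commute with [T]; [pid_mx a] keeps the first [a] columns
   and, as [a <= b], is undone by the [pid_mx a] in [D]. *)
pose G := row_mx T z%:M; pose F := col_mx z%:M (- T) *m (pid_mx a : 'M_(b, a)).
exists (fun x => eval_mx F x), (fun x => eval_mx G x).
apply: (linear_monad_cancel (D := row_mx (pid_mx a) 0) _ _ _ _ zy).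
- move=> i j; rewrite mxE; case: splitP => l _; first exact: hT.
  exact: multihomog_scalar_mx.
- move=> i j; rewrite -[1%N]addn0; apply: multihomog_mulmx => {i j} i j.
    rewrite mxE; case: splitP => l _; first exact: multihomog_scalar_mx.
    by rewrite mxE => mon; rewrite (perm_mem (msuppN _)); apply: hT.
  rewrite mxE; case: (_ && _); last exact: multihomog0.
  exact: multihomogC.
- by rewrite mulmxA mul_row_col mul_mx_scalar mul_scalar_mx scalerN subrr mul0mx.
- rewrite mulmxA mul_row_col mul0mx addr0 mul_mx_scalar -scalemxAl pid_mx_id //.
  by rewrite pid_mx_1 scalemx1.
move=> x; rewrite map_row_mx.
have -> : eval_mx (z%:M : 'M_r) x = (eval_at z x)%:M.
  exact: (map_scalar_mx (ev x)).
apply/inj_row_free => w; rewrite mul_mx_row => /eqP; rewrite row_mx_eq0 => /andP[/eqP wT].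
rewrite mul_mx_scalar scaler_eq0 => /orP[zx | /eqP //].
(* Where [z] vanishes, some other monomial does not, and it is a coefficient of [T], which then has
   full rank. *)
have [[|l] lt_l zlx] := coord_monomials_neq0 x; first by rewrite -/z zx in zlx.
apply/eqP; rewrite -(mulmx_free_eq0 w (B := eval_mx T x)) ?wT //.
apply: (row_free_band_poly (u := fun l => zs`_l.+1) _ zlx); first by rewrite ltn_predRL.
by move: le_b; rewrite subn2.
Qed.

(** The zero blocks make the composite vanish, so [T] alone must have full rank everywhere; it uses
    all [c] monomials, hence degree at most [c.-1]. *)
Lemma linear_monad_split r b a : (r + c.-1 <= b)%N ->
  exists (f : mproj K m k -> 'M[K]_(b + a, a)) (g : mproj K m k -> 'M[K]_(r, b + a)),
    linear_monad f g.
Proof.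
move=> le_b; have [y zy] := coord_monomials_head_neq0.
set z := zs`_0 in zy *; have hz : multihomog (fun=> 1%N) z := @multihomog_coord_monomials 0.
pose T : 'M[coord_ring K m k]_(r, b) := band_mx r b (\poly_(l < c) zs`_l).
pose G : 'M_(r, b + a) := row_mx T 0; pose F : 'M_(b + a, a) := col_mx 0 z%:M.
exists (fun x => eval_mx F x), (fun x => eval_mx G x).
apply: (linear_monad_cancel (D := row_mx 0 1%:M) _ _ _ _ zy).
- move=> i j; rewrite mxE; case: splitP => l _; last by rewrite mxE; apply: multihomog0.
  by apply: multihomog_band => e; apply: multihomog_coord_monomials.
- move=> i j; rewrite mxE; case: splitP => l _; last exact: multihomog_scalar_mx.
  by rewrite mxE; apply: multihomog0.
- by rewrite mul_row_col mulmx0 mul0mx addr0.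
- by rewrite mul_row_col mul0mx add0r mul1mx.
move=> x; have [l lt_l zlx] := coord_monomials_neq0 x.
rewrite map_row_mx; apply/inj_row_free => w; rewrite mul_mx_row => /eqP.
rewrite row_mx_eq0 => /andP[wT _]; apply/eqP; move: wT.
by rewrite mulmx_free_eq0 //; apply: (row_free_band_poly (u := nth 0 zs) lt_l zlx).
Qed.

End LinearMonads.

Theorem theorem3p1 (R : realType) (m n N alpha beta gamma : nat)
    (m_gt0 : 0 < m) (n_gt0 : 0 < n)
    (hN : has_h0 R[i] m (2 * n + 1) (diag_deg m 1%R) (N + 1))
    (alpha_gt0 : 0 < alpha) (beta_gt0 : 0 < beta) (gamma_gt0 : 0 < gamma)
    (hcond : (2 * gamma + N - 1 <= beta /\ alpha + gamma <= beta) \/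
             alpha + gamma + N <= beta) :
  exists (f : mproj R[i] m (2 * n + 1) -> 'M[R[i]]_(beta, alpha))
         (g : mproj R[i] m (2 * n + 1) -> 'M[R[i]]_(gamma, beta)),
    linear_monad f g.
Proof.
have le_c := @card_coord_monomial_le R[i] _ _ _ hN.
(* With [m] positive, [(2n+2)^m > m >= 1]; this makes [c - 2] an honest subtraction in the
   comparison with [N - 1]. *)
have c_gt1 : 1 < #|{ffun 'I_m -> 'I_(2 * n + 1).+1}|.
  rewrite card_ffun !card_ord; apply: leq_ltn_trans m_gt0 (ltn_expl _ _); lia.
case: hcond => [[le1 le2] | le3].
  (* In each case [beta] is split according to the two column blocks of [g]. *)
  have -> : beta = (beta - gamma) + gamma by lia.
  by apply: linear_monad_band_scalar; lia.
have -> : beta = (beta - alpha) + alpha by lia.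
by apply: linear_monad_split; lia.
Qed.
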